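(* $$\int_0^{\infty} e^{-x^2}\,\mathrm{erfc}(x)\,dx = \frac{\sqrt{\pi}}{4}.$$
   Context: The complementary error function is $\mathrm{erfc}(x)=\frac{2}{\sqrt{\pi}}\int_x^{\infty} e^{-t^2}\,dt$. *)

(* Defs.v *)
From mathcomp Require Import all_boot all_order all_algebra.
From mathcomp Require Import all_classical all_reals all_analysis.

Set Implicit Arguments.
Unset Strict Implicit.
Unset Printing Implicit Defensive.

Import Order.TTheory GRing.Theory Num.Theory.
Import numFieldNormedType.Exports.

Local Open Scope classical_set_scope.
Local Open Scope ring_scope.

Definition erfc (R : realType) (x : R) : R :=
  2 / Num.sqrt pi *
  \int[lebesgue_measure]_(t in `[x, +oo[) expR (- t ^+ 2).

(* Main.v *)
(* Up to the factor -2 / sqrt pi, the integrand is T' T, where T x is the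
   integral of the Gaussian over [x, +oo[ and T' x = - exp (- x ^ 2). Hence the
   integral is (2 / sqrt pi) (T 0) ^ 2 / 2 with T 0 = sqrt pi / 2, since T tends
   to 0 at infinity. *)
Require Import Defs.
From mathcomp Require Import all_boot all_order all_algebra.
From mathcomp Require Import all_classical all_reals all_analysis.
From mathcomp Require Import ring.

Import Order.TTheory GRing.Theory Num.Theory.
Import numFieldNormedType.Exports.

Local Open Scope classical_set_scope.
Local Open Scope ring_scope.

Definition gauss_tail {R : realType} (x : R) : R :=
  \int[lebesgue_measure]_(t in `[x, +oo[) gauss_fun t.

Lemma erfc_gauss_tail {R : realType} (x : R) :
  erfc x = 2 / Num.sqrt pi * gauss_tail x.
Proof. by []. Qed.

Lemma gauss_tail_ge0 {R : realType} (x : R) : 0 <= gauss_tail x.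
Proof. by apply: Rintegral_ge0 => // t _; exact: gauss_fun_ge0. Qed.

Lemma gauss_tail0 {R : realType} : gauss_tail (0 : R) = Num.sqrt pi / 2.
Proof. by rewrite /gauss_tail /Rintegral integral0y_gauss. Qed.

Lemma integrable_gauss_fun {R : realType} (A : set (measurableTypeR R)) :
  measurable A -> (@lebesgue_measure R).-integrable A (EFin \o gauss_fun).
Proof. by move=> mA; apply: integrableS (integrableT_gauss (R := R)). Qed.

(** The left bound [a] is kept general: [-oo] serves for the derivative of the tail, [0] for its
    limit. *)
Lemma gauss_tail_itvB {R : realType} (a : itv_bound R) (x : R) :
  (a <= BRight x)%O ->
  gauss_tail x = \int[lebesgue_measure]_(t in [set` Interval a +oo%O]) gauss_fun t -
    \int[lebesgue_measure]_(t in [set` Interval a (BRight x)]) gauss_fun t.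
Proof.
move=> ax; rewrite Rintegral_itvB//; last exact: integrable_gauss_fun.
(* The difference is the integral over []x, +oo[]; adding the point [x], of measure zero, does not
   change it. *)
by rewrite Rintegral_itv_obnd_cbnd//; exact: integrable_gauss_fun.
Qed.

(** The tail is a constant minus the primitive of the Gaussian based at [-oo]; this base point lies
    below every real [x], so the fundamental theorem of calculus applies everywhere. *)
Lemma is_derive_gauss_tail {R : realType} (x : R) :
  is_derive x 1 (@gauss_tail R) (- gauss_fun x).
Proof.
(* Any point beyond [x] would do: it only makes [x] interior to the interval of integration. *)
have xx1 : x < x + 1 by rewrite ltrDl.
have /= := @continuous_FTC1 _ _ -oo%O _ _ xx1 (integrable_gauss_fun _ _).
rewrite ltNyr => /(_ (measurable_itv _) isT (@continuous_gauss_fun R x))[dP PE].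
have -> : @gauss_tail R = (fun y => cst
      (\int[lebesgue_measure]_(t in `]-oo, +oo[) gauss_fun t) y -
      \int[lebesgue_measure]_(t in `]-oo, y]) gauss_fun t).
  by apply/funext => y; rewrite (gauss_tail_itvB -oo%O).
rewrite -[- gauss_fun x]sub0r -PE derive1E.
by apply: is_deriveB; exact: derivableP.
Qed.

(** For [x >= 0] the tail is [Num.sqrt pi / 2] minus the integral [I x] over [[0, x]], and [I x]
    tends to that same constant. *)
Lemma cvg_gauss_tail {R : realType} : @gauss_tail R x @[x --> +oo] --> (0 : R).
Proof.
pose I := @gauss_integral_proof.integral0_gauss R.
have I_sqrt x : Num.sqrt (I x ^+ 2) = I x.
  by rewrite sqrtr_sqr ger0_norm// gauss_integral_proof.integral0_gauss_ge0.
(* The known limit is that of [I x ^+ 2]; since [I x] is nonnegative, continuity of the square root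
   gives that of [I x]. *)
have I_cvg : I x @[x --> +oo] --> Num.sqrt (pi / 4 : R).
  under eq_fun do rewrite -I_sqrt.
  apply: continuous_cvg; first exact: sqrt_continuous.
  exact: gauss_integral_proof.cvg_integral0_gauss_sqr.
have sqrt_pi4 : Num.sqrt (pi / 4 : R) = Num.sqrt pi / 2.
  have -> : pi / 4 = (Num.sqrt pi / 2) ^+ 2 :> R.
    by rewrite expr_div_n sqr_sqrtr ?pi_ge0// -natrX.
  by rewrite sqrtr_sqr ger0_norm// divr_ge0// sqrtr_ge0.
rewrite -(subrr (Num.sqrt (pi / 4))).
apply: cvg_trans (cvgB (cvg_cst _) I_cvg); apply: near_eq_cvg; near=> x.
have x0 : 0 <= x by near: x; exact: nbhs_pinfty_ge.
rewrite (gauss_tail_itvB (BLeft 0)) ?bnd_simp// -/(gauss_tail 0) gauss_tail0.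
by rewrite -sqrt_pi4.
Unshelve. all: by end_near. Qed.

Theorem theorem4p8 (R : realType) :
  (\int[lebesgue_measure]_(x in `[0%R, +oo[) (expR (- x ^+ 2) * erfc x)%:E =
   (Num.sqrt pi / 4 : R)%:E)%E.
Proof.
have s0 : Num.sqrt pi != 0 :> R by rewrite gt_eqF// sqrtr_gt0 pi_gt0.
(* The factor is [2 / Num.sqrt pi] times [-1/2]: the half cancels the 2 from differentiating the
   square, the sign that of the derivative of the tail. *)
pose F (x : R) := - (Num.sqrt pi)^-1 * gauss_tail x ^+ 2.
have dF (x : R) : is_derive x 1 F (expR (- x ^+ 2) * erfc x).
  have dT := is_derive_gauss_tail x.
  apply: (is_derive_eq (is_deriveZ _ _)).
  by rewrite erfc_gauss_tail /GRing.scale/= -/(gauss_fun x); ring.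
have T_continuous : continuous (@gauss_tail R).
  move=> x; apply: differentiable_continuous; apply/derivable1_diffP.
  by have [] := is_derive_gauss_tail x.
(* The two zeros are the lower endpoint and the limit of [F] at [+oo], so the integral is
   [0 - F 0]. *)
rewrite (@ge0_continuous_FTC2y R _ F 0 0).
- by rewrite -EFinB /F gauss_tail0; congr EFin; field.
- move=> x _; rewrite erfc_gauss_tail.
  by rewrite !mulr_ge0 ?expR_ge0 ?invr_ge0 ?sqrtr_ge0 ?gauss_tail_ge0.
- apply: continuous_subspaceT => x; apply: cvgM.
    exact: continuous_gauss_fun.
  by apply: cvgM; [exact: cvg_cst|exact: T_continuous].
- rewrite -(mulr0 (- (Num.sqrt pi)^-1 : R)); apply: cvgM; first exact: cvg_cst.
  rewrite -[X in _ --> X](mulr0 (0 : R)).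
  by apply: cvgM; exact: cvg_gauss_tail.
- by move=> x _; have [] := dF x.
- apply: cvg_at_right_filter; apply: differentiable_continuous.
  by apply/derivable1_diffP; have [] := dF 0.
- by move=> x _; rewrite derive1E; have [_ ->] := dF x.
Qed.
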